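(* Let $0\le\lambda<1$ and $-1\le\rho\le 1$, and let $\mathcal{K}_{DC}$ be the $n\times n$ DC kernel with entries $(\mathcal{K}_{DC})_{ij}=\lambda^{\frac{i+j}{2}}\rho^{|i-j|}$, $i,j=1,\dots,n$. Consider the maximum entropy band extension problem with bandwidth $m=1$ and prescribed entries $$\sigma_{ij}=(\mathcal{K}_{DC})_{ij}=\rho^{|i-j|}\lambda^{\frac{i+j}{2}},\qquad |i-j|\le 1,$$ i.e. consider the partially specified 1-band matrix $$\Sigma_n^{(1)}(x)=\begin{bmatrix} \lambda & \lambda^{\frac32}\rho & x_{13} & \dots & \dots & x_{1n}\\ \lambda^{\frac32}\rho & \lambda^2 & \lambda^{\frac52}\rho & x_{24} & \dots & x_{2n}\\ x_{13} & \lambda^{\frac52}\rho & \lambda^3 & \lambda^{\frac72}\rho & & \vdots\\ \vdots & & \ddots & \ddots & \ddots & x_{n-2,n}\\ \vdots & & & \lambda^{\frac{2n-3}{2}}\rho & \lambda^{n-1} & \lambda^{\frac{2n-1}{2}}\rho\\ x_{1n} & \dots & \dots & x_{n-2,n} & \lambda^{\frac{2n-1}{2}}\rho & \lambda^n \end{bmatrix}$$ whose unspecified entries are collected in $x$. Let $x^o$ denote the optimal value of $x$ in this problem. Then $\Sigma_n^{(1)}(x^o)=\mathcal{K}_{DC}$, i.e. the solution of the maximum entropy band extension problem coincides with the DC kernel.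
   Context: The maximum entropy band extension problem with bandwidth $m$ is the following: given $\sigma_{ij}$ for $|i-j|\le m$, minimize $-\log\det\Sigma(x)$ over symmetric $n\times n$ matrices $\Sigma(x)$, subject to $\Sigma(x)\succ 0$ (positive definite) and $[\Sigma(x)]_{ij}=\sigma_{ij}$ for $|i-j|\le m$; here $x$ denotes the entries of $\Sigma$ that are not prescribed. Minimizing $-\log\det\Sigma$ amounts to maximizing the differential entropy of the zero-mean Gaussian distribution with covariance $\Sigma$. In general the DC kernel is defined with a scale factor, as $c\,\lambda^{\frac{i+j}{2}}\rho^{|i-j|}$ with $c\ge 0$, $0\le\lambda<1$, $-1\le\rho\le1$; the entries prescribed in the statement are those with $c=1$. *)

(* Defs.v *)
From HB Require Import structures.
From mathcomp Require Import all_boot all_order all_algebra.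
From mathcomp Require Import all_classical all_reals all_analysis.

Set Implicit Arguments.
Unset Strict Implicit.
Unset Printing Implicit Defensive.

Import Order.TTheory GRing.Theory Num.Theory.
Local Open Scope ring_scope.

(* Row and column indices run over 0, ..., n-1, so the (i, j) entry below is
   the (i+1, j+1) entry in the usual 1-based notation.  Since the exponent of
   lambda is positive, lambda = 0 gives the zero matrix; rho is raised to a
   natural power, with 0 ^+ 0 = 1. *)
Definition DC_kernel (R : realType) (n : nat) (lambda rho : R) : 'M[R]_n :=
  \matrix_(i < n, j < n)
    (lambda `^ ((i.+1 + j.+1)%:R / 2) * rho ^+ `|i - j|%N).

Definition posdefmx (R : realType) (n : nat) (S : 'M[R]_n) : Prop :=
  forall v : 'cV[R]_n, v != 0 -> 0 < (v^T *m S *m v) 0 0.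

(* Only the entries of sigma with |i - j| <= m are read. *)
Definition band_extension (R : realType) (n m : nat) (sigma S : 'M[R]_n)
    : Prop :=
  [/\ S \is symmetricmx,
      posdefmx S
    & forall i j : 'I_n, (`|i - j| <= m)%N -> S i j = sigma i j].

(* S minimizes - log det over all feasible completions of the m-band sigma;
   the free variable x of the problem is the off-band part of S. *)
Definition max_entropy_band_extension (R : realType) (n m : nat)
    (sigma S : 'M[R]_n) : Prop :=
  band_extension m sigma S /\
  (forall T : 'M[R]_n, band_extension m sigma T ->
     - ln (\det S) <= - ln (\det T)).

(* Main.v *)
Require Import Defs.
From mathcomp Require Import all_boot all_order all_algebra.
From mathcomp Require Import all_classical all_reals all_analysis.
From mathcomp Require Import zify lra.
Import Order.TTheory GRing.Theory Num.Theory.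
Local Open Scope ring_scope.

(** The DC kernel K is the covariance of an autoregressive process of order
    one: with a = sqrt lambda * rho, the innovations X_i - a X_(i-1) are
    uncorrelated.  In matrix form, the unit lower bidiagonal matrix L with -a
    below the diagonal makes L K L^T a diagonal matrix D
    ([innovation_DC_diag]).

    If T is any completion of the tridiagonal band of K, the variance that T
    gives to X_i - a X_(i-1) involves only entries in the band, so L T L^T has
    the same diagonal as D.  Hadamard's inequality ([hadamard_posdefmx]) gives
    det T = det (L T L^T) <= det D = det K, with equality only if L T L^T is
    diagonal, hence equal to D, that is, T = K ([banded_congruence_max_det]).
    The entries of D are diagonal entries of the positive definite matrix
    L T L^T, so the existence of one completion already makes K positive
    definite.  This settles optimality and uniqueness at all parameters at
    once; feasibility for 0 < lambda and |rho| < 1 follows from the values of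
    the innovation variances ([innovation_DC_variance]). *)

Set Implicit Arguments.
Unset Strict Implicit.
Unset Printing Implicit Defensive.

(** * Positive definite matrices and Hadamard's inequality *)

Section PositiveDefinite.
Variable R : realType.

Lemma posdefmx_diag_gt0 n (S : 'M[R]_n) (i : 'I_n) : posdefmx S -> 0 < S i i.
Proof.
move=> /(_ (delta_mx i 0)); rewrite trmx_delta -rowE -colE !mxE; apply.
by apply/eqP => /matrixP/(_ i 0)/eqP; rewrite !mxE !eqxx oner_eq0.
Qed.

Lemma posdefmx_diagonal n (S : 'M[R]_n) :
  is_diag_mx S -> (forall i, 0 < S i i) -> posdefmx S.
Proof.
move=> /is_diag_mxP Sdiag Spos v v0.
have -> : (v^T *m S *m v) 0 0 = \sum_i S i i * v i 0 ^+ 2.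
  rewrite mxE; apply: eq_bigr => i _; rewrite mxE (bigD1 i) //= big1 ?addr0.
    by rewrite !mxE mulrAC mulrC -expr2.
  by move=> j /Sdiag->; rewrite mulr0.
have [i vi0] : exists i, v i 0 != 0.
  apply/existsP; apply: contraNT v0 => /existsPn v0; apply/eqP/colP => i.
  by rewrite mxE; apply/eqP; rewrite -[_ == _]negbK; apply: v0.
rewrite (bigD1 i) //= ltr_pwDl //.
  by rewrite mulr_gt0 // lt_def sqr_ge0 sqrf_eq0 vi0.
by apply: sumr_ge0 => j _; rewrite mulr_ge0 ?sqr_ge0 // ltW.
Qed.

Lemma posdefmx_congr n (P S : 'M[R]_n) :
  P \in unitmx -> posdefmx S -> posdefmx (P *m S *m P^T).
Proof.
move=> Pu Spos v v0; have := Spos (P^T *m v).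
rewrite trmx_mul trmxK !mulmxA; apply; apply: contraNneq v0 => Pv0.
by rewrite -(mulKmx (_ : P^T \in unitmx) v) ?unitmx_tr // Pv0 mulmx0.
Qed.

Lemma posdefmx_congr_inv n (P S : 'M[R]_n) :
  P \in unitmx -> posdefmx (P *m S *m P^T) -> posdefmx S.
Proof.
move=> Pu Spos; rewrite -[S](mulKmx Pu) -(mulmxK (_ : P^T \in unitmx) (P *m S)).
  by rewrite mulmxA -trmx_inv; apply: posdefmx_congr; rewrite ?unitmx_inv.
by rewrite unitmx_tr.
Qed.

Lemma posdefmx_drsubmx n1 n2 (S : 'M[R]_(n1 + n2)) :
  posdefmx S -> posdefmx (drsubmx S).
Proof.
move=> Spos v v0; have := Spos (col_mx 0 v).
rewrite -{1}[S]submxK tr_col_mx trmx0 mul_row_block mul_row_col.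
by rewrite !(mul0mx, mulmx0, add0r); apply; rewrite col_mx_eq0 negb_and v0 orbT.
Qed.

(** With a Schur complement C = B - u^T u / a of the corner a, the
    determinant is a * det C, and passing from B to C decreases each diagonal
    entry by u_i ^ 2 / a; so no loss occurs only if u = 0 and C is diagonal. *)
Lemma hadamard_posdefmx n (S : 'M[R]_n) : S^T = S -> posdefmx S ->
  0 < \det S /\ \det S <= \prod_i S i i ?= iff is_diag_mx S.
Proof.
elim: n => [|n IHn] in S *.
  move=> _ _; rewrite det_mx00 big_ord0; split=> //.
  suff -> : is_diag_mx S by apply: leif_refl.
  by apply/is_diag_mxP => -[].
rewrite -[n.+1]/(1 + n)%N in S *; rewrite -[S]submxK.
move: (ulsubmx S) (ursubmx S) (dlsubmx S) (drsubmx S) => A u w B {S}.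
rewrite [A]mx11_scalar; move: (A 0 0) => {A} a.
rewrite tr_block_mx => /eq_block_mx[_ _ wE BT] Spos; move: wE => /= <- in Spos *.
set S := block_mx _ _ _ _ in Spos *.
have a0 : 0 < a.
  have := posdefmx_diag_gt0 (lshift n (0 : 'I_1)) Spos.
  by rewrite block_mxEul mxE.
pose C := B - a^-1 *: (u^T *m u).
pose P : 'M[R]_(1 + n) := block_mx 1%:M 0 (- a^-1 *: u^T) 1%:M.
have detP : \det P = 1 by rewrite det_lblock !det1 mulr1.
have PSE : P *m S *m P^T = block_mx a%:M 0 0 C.
  rewrite tr_block_mx !mulmx_block !trmx1 !trmx0 linearZ /= trmxK.
  rewrite !(mul1mx, mulmx1, mul0mx, mulmx0, addr0, add0r).
  rewrite -!scalemxAl !mul_mx_scalar mul_scalar_mx !scalerA mulrN mulNr.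
  rewrite divff ?gt_eqF // mulVf ?gt_eqF //.
  by rewrite !scaleN1r !addNr mul0mx add0r scaleNr addrC.
have Cpos : posdefmx C.
  rewrite -[C](@block_mxKdr _ 1 n 1 n a%:M 0 0 C) -PSE.
  by apply/posdefmx_drsubmx/posdefmx_congr; rewrite // unitmxE detP unitr1.
have CT : C^T = C by rewrite linearB linearZ /= trmx_mul trmxK BT.
have [detC0 detC] := IHn C CT Cpos.
have -> : \det S = a * \det C.
  have := congr1 determinant PSE; rewrite !det_mulmx det_tr detP mul1r mulr1.
  by rewrite det_ublock det_scalar1.
have -> : \prod_i S i i = a * \prod_i B i i.
  rewrite (@big_split_ord _ _ _ 1 n) big_ord1 /= block_mxEul mxE.
  by congr (_ * _); apply: eq_bigr => i _; rewrite block_mxEdr.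
split; first by rewrite mulr_gt0.
have CiE i : C i i = B i i - a^-1 * u 0 i ^+ 2.
  by rewrite !mxE big_ord1 !mxE -expr2.
have leCB i : C i i <= B i i ?= iff (u 0 i == 0).
  split; first by rewrite CiE gerBl mulr_ge0 ?sqr_ge0 // invr_ge0 ltW.
  rewrite CiE -subr_eq0 addrAC subrr add0r oppr_eq0 mulf_eq0 invr_eq0.
  by rewrite gt_eqF //= sqrf_eq0.
have B0 : \prod_i B i i != 0.
  rewrite gt_eqF // prodr_gt0 // => i _.
  by apply: lt_le_trans (leCB i); apply: posdefmx_diag_gt0.
have := leif_trans detC
  (leif_pprod (fun i _ => ltW (posdefmx_diag_gt0 i Cpos)) (fun i _ => leCB i)).
rewrite (negPf B0) /= => -[le_det eq_det]; split; first by rewrite ler_pM2l.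
rewrite (inj_eq (mulfI (lt0r_neq0 a0))) eq_det is_diag_block_mx // trmx_eq0.
have -> : [forall (i | true), u 0 i == 0] = (u == 0).
  apply/forallP/eqP => [u0|-> i]; last by rewrite mxE eqxx.
  by apply/rowP => i; rewrite mxE; apply/eqP/u0.
rewrite andbC; case: eqP => //= u0.
by rewrite scalar_mx_is_diag /C u0 mulmx0 scaler0 subr0.
Qed.

End PositiveDefinite.

(** * Completions diagonalized by a banded congruence *)

(** If every row of L is supported in a window of width m, then the diagonal
    of L T L^T reads only the m-band of T, so it is the same for all
    completions.  When L K L^T is diagonal, Hadamard's inequality for L T L^T
    therefore compares det T with det K. *)
Lemma banded_congruence_max_det (R : realType) n m (K L T : 'M[R]_n) :
    L \in unitmx ->
    (forall i k l, L i k != 0 -> L i l != 0 -> (`|k - l| <= m)%N) ->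
    is_diag_mx (L *m K *m L^T) -> band_extension m K T ->
  [/\ posdefmx K, 0 < \det T & \det T <= \det K ?= iff (T == K)].
Proof.
move=> Lu Lband Ddiag [/is_hermitianmxP]; rewrite expr0 scale1r map_mx_id //.
move=> /esym TT Tpos TK.
set D := L *m K *m L^T in Ddiag; pose M := L *m T *m L^T.
have MT : M^T = M by rewrite !trmx_mul trmxK TT mulmxA.
have Mpos : posdefmx M by apply: posdefmx_congr.
have MD i : M i i = D i i.
  rewrite !mxE; apply: eq_bigr => l _; rewrite !mxE.
  have [->|Lil] := eqVneq (L i l) 0; first by rewrite !mulr0.
  congr (_ * _); apply: eq_bigr => k _.
  have [->|Lik] := eqVneq (L i k) 0; first by rewrite !mul0r.
  by rewrite TK //; apply: Lband Lik Lil.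
have [detM0 leM] := hadamard_posdefmx MT Mpos.
have Dpos : posdefmx D.
  by apply: posdefmx_diagonal => // i; rewrite -MD; apply: posdefmx_diag_gt0.
have detD : \det D = \prod_i M i i.
  rewrite det_trig ?is_diag_mx_is_trig //.
  by apply: eq_bigr => i _; rewrite MD.
pose c := \det L ^+ 2.
have c0 : 0 < c by rewrite lt_def sqr_ge0 sqrf_eq0 -unitfE -unitmxE Lu.
have detE X : \det (L *m X *m L^T) = c * \det X.
  by rewrite !det_mulmx det_tr mulrAC -expr2.
split; first exact: posdefmx_congr_inv Dpos.
  by rewrite -(pmulr_rgt0 _ c0) -detE.
move: leM; rewrite -detD !detE => -[leM eqM].
split; first by rewrite -(ler_pM2l c0).
rewrite -(inj_eq (mulfI (lt0r_neq0 c0))) eqM.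
apply/idP/eqP => [/is_diag_mxP Mdiag|TKE]; last by rewrite /M TKE.
have {Mdiag} MDE : M = D.
  apply/matrixP => i j; have [<-//|ij] := eqVneq i j.
  by rewrite Mdiag // (is_diag_mxP Ddiag).
have LTu : L^T \in unitmx by rewrite unitmx_tr.
by apply: (can_inj (mulKmx Lu)); apply: (can_inj (mulmxK LTu)).
Qed.

(** * The autoregressive filter of the DC kernel *)

(** The map X_i |-> X_i - a X_(i-1) taking an autoregressive process of order
    one to its innovations. *)
Definition innovation_mx (R : realType) n (a : R) : 'M[R]_n :=
  \matrix_(i, k) ((i == k)%:R - a * (i == k.+1 :> nat)%:R).

Section DCKernel.
Variables (R : realType) (n : nat).
Implicit Types (a lambda rho : R).

Lemma innovation_mx_trig a : is_trig_mx (innovation_mx n a).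
Proof.
apply/is_trig_mxP => i k lt_ik; rewrite mxE -val_eqE /= ltn_eqF //.
by rewrite ltn_eqF ?mulr0 ?subr0 // ltnW.
Qed.

Lemma innovation_mx_unit a : innovation_mx n a \in unitmx.
Proof.
rewrite unitmxE det_trig ?innovation_mx_trig // big1 ?unitr1 // => i _.
by rewrite mxE eqxx ltn_eqF // mulr0 subr0.
Qed.

Lemma innovation_mx_band a (i k l : 'I_n) :
  innovation_mx n a i k != 0 -> innovation_mx n a i l != 0 ->
  (`|k - l| <= 1)%N.
Proof.
have supp (j : 'I_n) : innovation_mx n a i j != 0 ->
    (i == j :> nat) || (i == j.+1 :> nat).
  rewrite mxE -val_eqE /=; case: (i == j :> nat) (i == j.+1 :> nat) => -[] //.
  by rewrite mulr0 subr0 eqxx.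
by move=> /supp/orP[]/eqP+ /supp/orP[]/eqP; lia.
Qed.

(** The factor (0 < i)%:R is there for the first row of the filter, which has
    no predecessor. *)
Lemma innovation_mulmx a (f : nat -> nat -> R) (i j : 'I_n) :
  (innovation_mx n a *m \matrix_(k, l) f k l) i j =
  f i j - (0 < i)%:R * (a * f i.-1 j).
Proof.
rewrite mxE; under eq_bigr => k _ do rewrite !mxE mulrBl.
rewrite sumrB (bigD1 i) //= eqxx mul1r big1 ?addr0; last first.
  by move=> k /negPf ki; rewrite eq_sym ki mul0r.
congr (_ - _); case: i => -[|i] /= lt_in.
  by rewrite big1 ?mul0r // => k _; rewrite mulr0 mul0r.
rewrite (bigD1 (Ordinal (ltnW lt_in))) //= eqxx mulr1 mul1r big1 ?addr0 //.
by move=> k; rewrite -val_eqE /= eqSS eq_sym => /negPf->; rewrite mulr0 mul0r.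
Qed.

Lemma DC_kernelE lambda rho : 0 <= lambda ->
  DC_kernel n lambda rho =
  \matrix_(i, j) (Num.sqrt lambda ^+ (i.+1 + j.+1) * rho ^+ `|i - j|%N).
Proof.
move=> l0; apply/matrixP => i j; rewrite !mxE (mulrC _ 2^-1) powRrM powR12_sqrt //.
by rewrite powR_mulrn ?sqrtr_ge0.
Qed.

Lemma DC_kernel_tr lambda rho :
  (DC_kernel n lambda rho)^T = DC_kernel n lambda rho.
Proof. by apply/matrixP => i j; rewrite !mxE addnC distnC. Qed.

Section Filtered.
Variables (lambda rho : R).
Hypothesis lambda_ge0 : 0 <= lambda.
Let L := innovation_mx n (Num.sqrt lambda * rho).
Let K := DC_kernel n lambda rho.

(** Strictly below the diagonal, each row of K is sqrt lambda * rho times the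
    previous one. *)
Lemma innovation_DC_upper (i j : 'I_n) : (j < i)%N -> (L *m K) i j = 0.
Proof.
move=> lt_ji; rewrite /K DC_kernelE //.
rewrite (innovation_mulmx _ (fun k l => _ ^+ (k.+1 + l.+1) * _ ^+ `|k - l|%N)).
have i0 : (0 < i)%N by apply: leq_ltn_trans lt_ji.
rewrite i0 mul1r mulrACA -!exprS; apply/eqP; rewrite subr_eq0; apply/eqP.
by congr (_ ^+ _ * _ ^+ _); lia.
Qed.

(** L K and L^T are both upper triangular, hence so is L K L^T, which is also
    symmetric. *)
Lemma innovation_DC_diag : is_diag_mx (L *m K *m L^T).
Proof.
set D := L *m K *m L^T.
have DT : D^T = D by rewrite !trmx_mul trmxK DC_kernel_tr mulmxA.
have Dlow (i j : 'I_n) : (j < i)%N -> D i j = 0.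
  move=> lt_ji; rewrite mxE big1 // => k _.
  have [lt_ki|le_ik] := ltnP k i; first by rewrite innovation_DC_upper ?mul0r.
  rewrite [X in _ * X]mxE (is_trig_mxP (innovation_mx_trig _)) ?mulr0 //.
  exact: leq_trans le_ik.
apply/is_diag_mxP => i j; rewrite neq_ltn => /orP[lt_ij|/Dlow//].
by rewrite -DT mxE Dlow.
Qed.

Lemma innovation_DC_variance (i : 'I_n) :
  (L *m K *m L^T) i i =
  if i == 0 :> nat then lambda else lambda ^+ i.+1 * (1 - rho ^+ 2).
Proof.
have -> : (L *m K *m L^T) i i = (L *m K) i i.
  rewrite mxE (bigD1 i) //= big1 => [|k]; rewrite ?addr0.
    by rewrite !mxE eqxx ltn_eqF // !mulr0 subr0 mulr1.
  rewrite -val_eqE neq_ltn => /orP[/innovation_DC_upper->|lt_ik].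
    by rewrite mul0r.
  by rewrite [X in _ * X]mxE (is_trig_mxP (innovation_mx_trig _)) ?mulr0.
rewrite /K DC_kernelE //.
rewrite (innovation_mulmx _ (fun k l => _ ^+ (k.+1 + l.+1) * _ ^+ `|k - l|%N)).
rewrite distnn mulr1; case: i => -[|i] /= _.
  by rewrite mul0r subr0 addn1 sqr_sqrtr.
rewrite mul1r mulrACA -!exprS.
have -> : `|i - i.+1|.+1 = 2%N by lia.
rewrite -{3}[lambda]sqr_sqrtr // -exprM mulrBr mulr1.
by congr (_ ^+ _ - _ ^+ _ * _); lia.
Qed.

Lemma DC_kernel_posdef : 0 < lambda -> -1 < rho < 1 -> posdefmx K.
Proof.
move=> lambda_gt0 /andP[rho_gt rho_lt].
apply: (posdefmx_congr_inv (innovation_mx_unit _)).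
apply: posdefmx_diagonal innovation_DC_diag _ => i.
rewrite innovation_DC_variance; case: ifP => // _.
by rewrite mulr_gt0 ?exprn_gt0 //; nra.
Qed.

Lemma DC_kernel_band_extension m : posdefmx K -> band_extension m K K.
Proof.
move=> Kpos; split=> //; apply/is_hermitianmxP.
by rewrite expr0 scale1r map_mx_id // DC_kernel_tr.
Qed.

Lemma DC_kernel_max_det (T : 'M[R]_n) : band_extension 1 K T ->
  [/\ band_extension 1 K K, 0 < \det T & \det T <= \det K ?= iff (T == K)].
Proof.
move=> Text; have [Kpos T0 leT] := banded_congruence_max_det
  (innovation_mx_unit _) (@innovation_mx_band _) innovation_DC_diag Text.
by split=> //; apply: DC_kernel_band_extension.
Qed.

End Filtered.
End DCKernel.

Theorem mainTheorem1 (R : realType) (n : nat) (lambda rho : R)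
    (hlambda : 0 <= lambda < 1) (hrho : -1 <= rho <= 1) :
  [/\ (* every optimal completion is the DC kernel *)
      forall S : 'M[R]_n,
        max_entropy_band_extension 1 (DC_kernel n lambda rho) S ->
        S = DC_kernel n lambda rho,
      (* whenever the problem is feasible, the DC kernel is optimal *)
      (exists S : 'M[R]_n, band_extension 1 (DC_kernel n lambda rho) S) ->
        max_entropy_band_extension 1 (DC_kernel n lambda rho)
          (DC_kernel n lambda rho)
    & (* the problem is feasible away from the degenerate parameters *)
      0 < lambda -> -1 < rho < 1 ->
        exists S : 'M[R]_n, band_extension 1 (DC_kernel n lambda rho) S].
Proof.
have lambda0 : 0 <= lambda by case/andP: hlambda.
set K := DC_kernel n lambda rho.
split.
- move=> S [Sext Sopt]; have [Kext S0 leS] := DC_kernel_max_det lambda0 Sext.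
  have K0 : 0 < \det K by apply: lt_le_trans leS.
  apply/eqP; rewrite -leS eq_le leS /=.
  by rewrite -ler_ln ?posrE // -lerN2 Sopt.
- move=> [S Sext]; have [Kext _ _] := DC_kernel_max_det lambda0 Sext.
  split=> // T Text; have [_ T0 leT] := DC_kernel_max_det lambda0 Text.
  have K0 : 0 < \det K by apply: lt_le_trans leT.
  by rewrite lerN2 ler_ln ?posrE // leT.
- move=> lambda_gt0 rho_lt1; exists K.
  by apply: DC_kernel_band_extension; apply: DC_kernel_posdef.
Qed.
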